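(* Let $\alpha$ be an algebraic number of degree $6$ over $\mathbb{Q}$ with $tr(\alpha)=0$. Suppose that some four distinct algebraic conjugates $\alpha_1,\alpha_2,\alpha_3,\alpha_4$ of $\alpha$ satisfy $$\alpha_{1}+\alpha_{2}=\alpha_{3}+\alpha_{4}\notin\mathbb{Q}.$$ Then the Galois group of the normal closure of $\mathbb{Q}(\alpha)$ over $\mathbb{Q}$ is isomorphic to one of the following three groups: the dihedral group $D_6$ of order $12$, the symmetric group $S_3$, or the cyclic group $C_6$ of order $6$.
   Context: Algebraic conjugates and degree are over $\mathbb{Q}$; the algebraic conjugates of $\alpha$ (including $\alpha$ itself) are the complex roots of its minimal polynomial over $\mathbb{Q}$. The trace $tr(\alpha)$ is the absolute trace, i.e. the sum of all algebraic conjugates of $\alpha$. *)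

(* Defs.v *)
From HB Require Import structures.
From mathcomp Require Import all_boot all_order all_algebra all_fingroup.
From mathcomp Require Import all_solvable all_field.

Set Implicit Arguments.
Unset Strict Implicit.
Unset Printing Implicit Defensive.

Import GRing.Theory.
Local Open Scope ring_scope.

Definition alg_degree (alpha : algC) : nat := (size (minCpoly alpha)).-1.

(* minCpoly alpha is monic, so this is the list of its roots with
   multiplicity; the list has no repetition by alg_conjugates_uniq. *)
Definition alg_conjugates (alpha : algC) : seq algC :=
  sval (closed_field_poly_normal (minCpoly alpha)).

Definition alg_trace (alpha : algC) : algC :=
  \sum_(z <- alg_conjugates alpha) z.

(* Since L is a splitting field over F0, it is normal over F0, and
   normalField 1 E expresses that E is normal over the base field F0. *)
Definition is_normal_closure (F0 : fieldType) (L : splittingFieldType F0)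
    (K E : {subfield L}) : Prop :=
  [/\ (K <= E)%VS, normalField 1 E
    & forall M : {subfield L},
        (K <= M)%VS -> normalField 1 M -> (E <= M)%VS].

Lemma minCpoly_alg_conjugates (alpha : algC) :
  minCpoly alpha = \prod_(z <- alg_conjugates alpha) ('X - z%:P).
Proof.
rewrite /alg_conjugates; case: closed_field_poly_normal => r /= Dr.
by rewrite {1}Dr (monicP (minCpoly_monic alpha)) scale1r.
Qed.

Lemma mem_alg_conjugates (alpha z : algC) :
  (z \in alg_conjugates alpha) = root (minCpoly alpha) z.
Proof. by rewrite minCpoly_alg_conjugates root_prod_XsubC. Qed.

Lemma size_alg_conjugates (alpha : algC) :
  size (alg_conjugates alpha) = alg_degree alpha.
Proof. by rewrite /alg_degree minCpoly_alg_conjugates size_prod_XsubC. Qed.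

Lemma minCpoly_minPoly (L : fieldExtType rat)
    (iota : {rmorphism L -> algC}) (a : L) :
  minCpoly (iota a) = map_poly iota (minPoly 1 a).
Proof.
have [p [Dp mon_p] dv_p] := minCpolyP (iota a).
have Dratr (q : {poly rat}) :
    map_poly iota (map_poly (in_alg L) q) = map_poly ratr q.
  rewrite -map_poly_comp; apply: eq_map_poly => x /=.
  exact: (fmorph_eq_rat (iota \o in_alg L)).
apply/eqP; rewrite -eqp_monic ?minCpoly_monic ?map_monic ?monic_minPoly //.
have /polyOver1P[q Dq] := minPolyOver 1%AS a.
apply/andP; split.
  rewrite Dq Dratr Dp dvdp_map -dv_p -Dratr -Dq fmorph_root.
  exact: root_minPoly.
rewrite Dp -Dratr dvdp_map; apply: minPoly_dvdp.
  by apply/polyOver1P; exists p.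
by rewrite -(fmorph_root iota) Dratr -Dp root_minCpoly.
Qed.

Lemma alg_conjugates_uniq (alpha : algC) : uniq (alg_conjugates alpha).
Proof.
have [L [iota [[|a [|//]] //= [<-] _]]] := num_field_exists [:: alpha].
rewrite -separable_prod_XsubC -minCpoly_alg_conjugates minCpoly_minPoly.
rewrite separable_map; apply: pcharf0_separable => p.
by rewrite pchar_lalg Num.Theory.pchar_num.
Qed.

Lemma normal_closure_exists (alpha : algC) :
  exists (L : splittingFieldType rat) (iota : {rmorphism L -> algC}) (a : L)
    (E : {subfield L}),
    iota a = alpha /\ is_normal_closure <<1; a>>%AS E.
Proof.
have [L [iota [s Ds genL]]] := num_field_exists (alg_conjugates alpha).
have [a s_a Da] : exists2 a, a \in s & iota a = alpha.
  have: alpha \in [seq iota x | x <- s].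
    by rewrite Ds mem_alg_conjugates root_minCpoly.
  by case/mapP=> a sa ->; exists a.
have Dpoly : minPoly 1 a = \prod_(z <- s) ('X - z%:P).
  apply: (map_poly_inj iota); rewrite -minCpoly_minPoly Da.
  rewrite minCpoly_alg_conjugates -Ds big_map rmorph_prod; apply: eq_bigr => z _ /=.
  by rewrite rmorphB /= map_polyX map_polyC.
have splitL : SplittingField.axiom L.
  exists (minPoly 1 a); first exact: minPolyOver.
  by exists s; rewrite // Dpoly eqpxx.
pose mixL := FieldExt_isSplittingField.Build rat L splitL.
pose sL : splittingFieldType rat := HB.pack L mixL.
exists sL, iota, a, {:sL}%AS; split=> //; split.
- exact: subvf.
- exact: normalFieldf.
move=> M sKM /normalFieldP nM.
have [r /allP/= Mr Dr] := nM a (subvP sKM a (memv_adjoin 1 a)).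
rewrite -[X in (X <= _)%VS]genL; apply/Fadjoin_seqP; split; first exact: sub1v.
move=> z s_z; apply: Mr; rewrite -root_prod_XsubC -Dr.
suff: root (minPoly (aspace1 L) a) z by [].
by rewrite Dpoly root_prod_XsubC.
Qed.

(* Main.v *)
Require Import Defs.
From HB Require Import structures.
From mathcomp Require Import all_boot all_order all_algebra all_fingroup.
From mathcomp Require Import all_solvable all_field.
From mathcomp Require Import zify.

Set Implicit Arguments.
Unset Strict Implicit.
Unset Printing Implicit Defensive.

Import GRing.Theory.
Local Open Scope ring_scope.

(** Let b be the common value of a1 + a2 and a3 + a4, and let a5, a6 be the
    other two conjugates. As the trace is 0, a5 + a6 = -2b, and b is nonzero
    because it is irrational.

    The key point is that the Galois images of the pair {a5, a6} partition the
    six conjugates into three blocks. Two pairs of conjugates with the same sum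
    are disjoint, so for each conjugate c of b exactly two pairs have sum c
    (three would force the trace to be 3c), and the pair complementary to both
    has sum -2c. No conjugate of b equals -2 times another one, as Galois
    automorphisms have finite order. Each image of {a5, a6} thus brings with it
    two further pairs, all these pairs are distinct, and there are 15 pairs in
    all: hence at most five images ([card_blocks_le5]). As every conjugate lies
    in the same number of images, their number is a multiple of 3, so there are
    three and they are disjoint ([card_blocks]).

    Write the blocks as {s + u, s - u}. The pair {a1, a2} is not a block, so
    up to exchanging a3 and a4 the remaining blocks are {a1, a3} and {a2, a4},
    and the relation a1 - a3 = a4 - a2 says that u is the same for both up to
    sign. By conjugation the three values of u agree up to sign
    ([gap_pm_all]). An automorphism is therefore determined by its permutation
    of the blocks and by its sign on u, which embeds the Galois group into the
    product of S_3 and a group of order 2. Transitivity on the six conjugates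
    makes the order divisible by 6, and a subgroup of that product of order
    divisible by 6 is one of the three groups ([embed_sym3_sign_isog]). *)

(** * Subgroups of the product of S_3 with a group of order 2 *)

(** The hypotheses say that [(f, eps)] embeds [G] into the direct product of
    'S_3 and a group of order 2, itself dihedral of order 12; so [G] has order
    6 or 12. In order 12 the embedding is onto, and preimages of (a 3-cycle,
    -1) and of (a transposition, +1) are the rotation and the reflection of a
    dihedral presentation. In order 6, a nonabelian [G] must embed by [f] alone:
    a nontrivial element of the kernel of [f] would be central of order 2, so
    that the quotient of [G] by its center would be cyclic, and [G] abelian. *)
Lemma embed_sym3_sign_isog (gT : finGroupType) (G : {group gT})
    (f : {morphism G >-> 'S_3}) (eps : gT -> bool) :
  {in G &, forall g h, eps (g * h)%g = eps g (+) eps h} ->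
  {in G, forall g, f g = 1%g -> eps g = false -> g = 1%g} ->
  (6 %| #|G|)%N ->
  [\/ G \isog [set: 'D_12], G \isog [set: 'S_3] | G \isog [set: 'Z_6] ]%g.
Proof.
move=> epsM inj1 dvd6.
have eps1 : eps 1%g = false.
  by have := epsM 1%g 1%g (group1 G) (group1 G); rewrite mulg1; case: (eps 1%g).
have epsV g : g \in G -> eps g^-1%g = eps g.
  move=> Gg; have := epsM g g^-1%g Gg (groupVr Gg).
  by rewrite mulgV eps1; case: (eps g); case: (eps _).
have inj g h : g \in G -> h \in G -> f g = f h -> eps g = eps h -> g = h.
  move=> Gg Gh fgh egh; apply/eqP; rewrite eq_mulgV1; apply/eqP.
  apply: inj1; rewrite ?groupM ?groupV //.
    by rewrite morphM ?groupV // morphV // fgh mulgV.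
  by rewrite epsM ?groupV // epsV // egh addbb.
pose F g := (f g, eps g).
have injF : {in G &, injective F}.
  by move=> g h Gg Gh [fgh egh]; apply: inj.
have oSB : #|{: 'S_3 * bool}| = 12%N by rewrite card_prod card_bool card_Sn.
have le12 : (#|G| <= 12)%N.
  rewrite -(card_in_imset injF).

 rewrite -oSB.
 exact: max_card.
have [oG | oG] : #|G| = 6%N \/ #|G| = 12%N.
  move: dvd6 le12 (cardG_gt0 G) => /dvdnP[k ->].
  by case: k => [|[|[|k]]] //; [left | right].
- case abG : (abelian G).
    have [u Gu ou] : {u | u \in G & #[u]%g = 2%N} by apply: Cauchy; rewrite ?oG.
    have [v Gv ov] : {v | v \in G & #[v]%g = 3%N} by apply: Cauchy; rewrite ?oG.
    have cG : cyclic G.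
      apply/cyclicP; exists (u * v)%g; apply/eqP; rewrite eq_sym eqEcard.
      rewrite cycle_subG groupM //= oG -orderE orderM ?ou ?ov //.
      exact: (centsP abG).
    apply: Or33; rewrite isog_cyclic_card // cardsT card_ord oG eqxx andbT.
    by apply/cyclicP; exists (Zp1 : 'Z_6); apply: Zp_cycle.
  apply: Or32; have injf : ('injm f)%g.
    apply/subsetP=> z /morphpreP[Gz /set1P fz]; apply/set1P.
    apply: contraFeq abG => nz1.
    have ez : eps z = true by case E: (eps z) => //; rewrite (inj1 z) ?eqxx in nz1.
    have Zz : z \in ('Z(G))%g.
      apply/centerP; split=> // g Gg; apply: inj; rewrite ?groupM //.
        by rewrite !morphM // fz mulg1 mul1g.
      by rewrite !epsM // addbC.
    have oz : #[z]%g = 2%N.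
      apply/prime_nt_dvdP => //; first by rewrite order_eq1.
      rewrite order_dvdn; apply/eqP/inj1; rewrite ?groupX //.
        by rewrite morphX // fz expg1n.
      by rewrite expgS expg1 epsM // addbb.
    have oGZ: (#|(G / 'Z(G))%g| * #|'Z(G)%g| = 6)%N.
      by rewrite card_quotient ?gFnorm // mulnC Lagrange ?oG // center_sub.
    have /dvdnP[k oZ] : (2 %| #|'Z(G)%g|)%N by rewrite -oz order_dvdG.
    have : (#|(G / 'Z(G))%g| %| 3)%N.
      by rewrite -(@dvdn_pmul2r 2) // -[(3 * 2)%N]/6%N -oGZ oZ (mulnC k) mulnA dvdn_mulr.
    rewrite dvdn_divisors // !inE => /orP[] /eqP oQ.
      apply: (@cyclic_center_factor_abelian _ G).
      by rewrite (card1_trivg oQ) cyclic1.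
    by apply: (@cyclic_center_factor_abelian _ G); rewrite prime_cyclic ?oQ.
  apply/isogP; exists f => //; apply/eqP; rewrite eqEcard subsetT /=.
  by rewrite card_injm // cardsT card_Sn oG.
- apply: Or31.
  have onto s b : exists g, [/\ g \in G, f g = s & eps g = b].
    have : (s, b) \in F @: G.
      suff -> : F @: G = setT by rewrite inE.
      by apply/eqP; rewrite eqEcard subsetT cardsT oSB card_in_imset // oG.
    by case/imsetP=> g Gg [-> ->]; exists g.
  pose i0 : 'I_3 := inord 0; pose i1 : 'I_3 := inord 1; pose i2 : 'I_3 := inord 2.
  pose s := tperm i0 i1; pose t := tperm i1 i2.
  have s2 : (s * s = 1)%g by apply: tperm2.
  have nst : (s * t != t * s)%g.
    apply/eqP=> /permP/(_ i0); rewrite !permM tpermL tpermL.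
    rewrite [t i0]tpermD ?tpermL -?val_eqE /= ?inordK //.
    by move/(congr1 val); rewrite /= !inordK.
  (* From the braid relation sts = tst. *)
  have st3 : ((s * t) ^+ 3 = 1)%g.
    have sts : (s * t * s = t * s * t)%g.
      have -> : (s * t * s = t ^ s)%g by rewrite conjgE tpermV mulgA.
      have -> : (t * s * t = s ^ t)%g by rewrite conjgE tpermV mulgA.
      by rewrite !tpermJ tpermR tpermL !tpermD // -?val_eqE /= ?inordK.
    have t2 : (t * t = 1)%g by apply: tperm2.
    rewrite !expgS expg0 mulg1 !mulgA sts -!mulgA (mulgA t t) t2 mul1g.
    by rewrite (mulgA s s) s2 mul1g.
  have [x [Gx fx ex]] := onto (s * t)%g true.
  have [y [Gy fy ey]] := onto s false.
  have fx1 : f x != 1%g.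
    rewrite fx; apply: contra nst => /eqP st1; rewrite st1 eq_sym.
    by rewrite -(inj_eq (mulgI s)) mulgA st1 mulg1 mul1g.
  have fx3 : (f x ^+ 3 = 1)%g by rewrite fx.
  have fx2 : (f x ^+ 2 != 1)%g.
    by apply: contra fx1 => /eqP fx2; rewrite -fx3 expgS fx2 mulg1.
  have ex3 : eps (x ^+ 3)%g by rewrite !expgS mulg1 !epsM ?groupM // ex.
  have ox : #[x]%g = 6%N.
    have : (#[x]%g \in divisors 6).
      rewrite -dvdn_divisors // order_dvdn; apply/eqP/inj1; first exact: groupX.
        by rewrite morphX // (expgM _ 3 2) fx3 expg1n.
      by rewrite (expgM _ 3 2) expgS expg1 epsM ?groupX // addbb.
    rewrite (_ : divisors 6 = [:: 1; 2; 3; 6]%N) // !inE.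
    have := expg_order x => xo /or4P[] /eqP o //; rewrite o in xo.
    - by case/eqP: fx1; rewrite -[x]expg1 xo morph1.
    - by case/eqP: fx2; rewrite -morphX // xo morph1.
    - by move: ex3; rewrite xo eps1.
  have yx : (x ^ y = x^-1)%g.
    apply: inj; rewrite ?groupJ ?groupV //; last first.
      by rewrite epsV // conjgE !epsM ?groupM ?groupV // epsV // ey ex.
    by rewrite morphJ // morphV // fx fy conjgE invMg !tpermV -/s mulgA -mulgA !mulgA s2 mul1g.
  have y2 : (y ^+ 2 = 1)%g.
    by apply: inj1; rewrite ?groupX // expgS expg1 ?epsM ?addbb // morphM // fy.
  (* The subgroup has order at least 6, and it is not [<[x]>], since [y] does
     not commute with [x]. *)
  have genG : G :=: (<[x]> <*> <[y]>)%g.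
    have sHG : (<[x]> <*> <[y]> \subset G)%g by rewrite join_subG !cycle_subG Gx.
    apply/esym/eqP; rewrite eqEcard sHG /=.
    have dvH : (6 %| #|(<[x]> <*> <[y]>)%g|)%N.
      by rewrite -ox orderE cardSg ?joing_subl.
    have := dvdn_leq (cardG_gt0 _) dvH; rewrite leq_eqVlt => /orP[/eqP oH|gt6].
      have /eqP defH : <[x]>%g == (<[x]> <*> <[y]>)%g.
        by rewrite eqEcard joing_subl -oH -orderE ox.
      have yX : y \in <[x]>%g by rewrite defH mem_gen // inE cycle_id orbT.
      have : (x ^ y = x)%g.
        by apply/conjg_fixP/commgP/esym; apply: (centsP (cycle_abelian x)); rewrite ?cycle_id.
      rewrite yx => xV; have : (x ^+ 2 = 1)%g by rewrite expgS expg1 -{1}xV mulVg.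
      by move/eqP; rewrite -order_dvdn ox.
    case/dvdnP: dvH gt6 => [[|[|k]] ->] //; rewrite oG => _.
    by rewrite (@leq_mul 2 6).
  rewrite isogEcard (@card_dihedral 6) // oG leqnn andbT.
  rewrite (@Grp_dihedral 6) //; apply/existsP; exists (x, y) => /=.
  by rewrite !xpair_eqE -genG eqxx y2 yx -ox expg_order !eqxx.
Qed.

(** * Group actions on finite families *)

Lemma stable_family_morphism (gT : finGroupType) (G : {group gT})
    (X : eqType) (op : X -> gT -> X) (T : finType) (t : T -> X) :
  injective t ->
  (forall i, op (t i) 1%g = t i) ->
  {in G &, forall g h i, op (t i) (g * h)%g = op (op (t i) g) h} ->
  {in G, forall g i, exists j, op (t i) g = t j} ->
  exists f : {morphism G >-> {perm T}},
    {in G, forall g i, op (t i) g = t (f g i)}.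
Proof.
move=> injt op1 opM stab.
have /fin_all_exists[f fP] (g : gT) :
    exists s : {perm T}, g \in G -> forall i, op (t i) g = t (s i).
  have [Gg | notGg] := boolP (g \in G); last by exists 1%g.
  have /fin_all_exists[s sP] := stab g Gg.
  have injs : injective s.
    move=> i j eq_s; apply: injt; rewrite -[t i]op1 -[t j]op1 -(mulgV g).
    by rewrite !opM ?groupV // !sP eq_s.
  by exists (perm injs) => _ i; rewrite permE.
have fM : {in G &, {morph f : g h / (g * h)%g}}.
  move=> g h Gg Gh; apply/permP=> i; apply: injt.
  by rewrite permM -!fP ?groupM // opM // fP.
by exists (Morphism fM).
Qed.

Lemma imset_permM (T : finType) (g h : {perm T}) (A : {set T}) :
  (g * h)%g @: A = h @: (g @: A).
Proof. by rewrite -imset_comp; apply: eq_imset => i; rewrite /= permM. Qed.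

Lemma imset_perm1 (T : finType) (A : {set T}) : (1%g : {perm T}) @: A = A.
Proof. by rewrite -[RHS]imset_id; apply: eq_imset => i; rewrite perm1. Qed.

Lemma pair_setP (T : finType) (A : {set T}) i : #|A| = 2%N -> i \in A ->
  exists2 j, j != i & A = [set i; j].
Proof.
move/eqP/cards2P=> [x [y [nxy ->]]]; rewrite !inE => /orP[] /eqP->.
  by exists y; rewrite // eq_sym.
by exists x; rewrite // setUC.
Qed.

Lemma card_perm_imset (T : finType) (h : {perm T}) (A : {set T}) : #|h @: A| = #|A|.
Proof. by rewrite card_imset //; apply: perm_inj. Qed.

Lemma mulr2n_inj (V : lmodType rat) (x y : V) : x *+ 2 = y *+ 2 -> x = y.
Proof.
move/eqP; rewrite -subr_eq0 -mulrnBl -scaler_nat scaler_eq0.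
by rewrite Num.Theory.pnatr_eq0 subr_eq0 => /eqP.
Qed.

(** * Six points with zero sum and a relation between two pairs *)

Section Configuration.

Variables (T : finType) (V : lmodType rat) (t : T -> V) (H : {group {perm T}}).

Definition subsum (A : {set T}) : V := \sum_(i in A) t i.

(** Rational relations between the points [t i] are preserved by [H]: this is
    all that remains of field automorphisms. *)
Hypothesis linH : {in H, forall h : {perm T}, exists sigma : {additive V -> V},
  forall i, sigma (t i) = t (h i)}.

Lemma subsum_act (h : {perm T}) : h \in H -> exists sigma : {additive V -> V},
  (forall i, sigma (t i) = t (h i)) /\
  forall A, sigma (subsum A) = subsum (h @: A).
Proof.
case/linH=> sigma sE; exists sigma; split=> // A.
rewrite /subsum raddf_sum big_imset /=; last by move=> i j _ _; apply: perm_inj.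
by apply: eq_bigr.
Qed.

(** If [h] multiplied a sum by -2, its n-th power would multiply it by
    (-2)^n; but [h] has finite order. *)
Lemma subsum_conj_neq_N2 (h : {perm T}) (A : {set T}) :
  h \in H -> subsum (h @: A) = - (subsum A *+ 2) -> subsum A = 0.
Proof.
move=> Hh S2; have [sigma [_ sS]] := subsum_act Hh.
have iterS n : subsum ((h ^+ n)%g @: A) = subsum A *~ ((- 2%:Z) ^+ n).
  elim: n => [|n IHn]; first by rewrite imset_perm1.
  rewrite expgSr imset_permM -sS IHn raddfMz sS S2 exprS mulrzA.
  by rewrite mulrNz mulNrz -!mulrzA mulrC.
have := iterS #[h]%g; rewrite expg_order imset_perm1 => /eqP.
rewrite -{1}[subsum A]mulr1z -subr_eq0 -mulrzBr -scaler_int scaler_eq0 intr_eq0.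
case/orP=> [|/eqP//]; rewrite subr_eq0 => /eqP/(congr1 absz).
rewrite abszX => /eqP; rewrite -[`|1%R|%N]/(2 ^ 0)%N (@eqn_exp2l 2) // => /eqP o0.
by have := order_gt0 h; rewrite -o0.
Qed.

Lemma subsum_pair i j : j != i -> subsum [set i; j] = t i + t j.
Proof. by move=> nij; rewrite /subsum big_setU1 ?big_set1 // inE eq_sym. Qed.

Hypothesis injt : injective t.

(** Two pairs sharing a point and having the same sum share their other
    point, by cancellation. *)
Lemma eq_sum_pairs_disjoint (A B : {set T}) :
  #|A| = 2%N -> #|B| = 2%N -> subsum A = subsum B -> A != B -> [disjoint A & B].
Proof.
move=> oA oB eqS; apply: contraR; rewrite -setI_eq0 => /set0Pn[i /setIP[Ai Bi]].
have [j nj defA] := pair_setP oA Ai; have [k nk defB] := pair_setP oB Bi.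
move: eqS; rewrite defA defB !subsum_pair // => /addrI/injt->; exact: eqxx.
Qed.

Hypothesis oT : #|T| = 6%N.
Hypothesis sum0 : \sum_i t i = 0.

(** Pairs with the same sum [c] are disjoint, so three of them would exhaust
    the six points, and the total sum would be [c *+ 3], which is not 0. *)
Lemma card_eq_sum_pairs (c : V) :
  c != 0 -> (#|[set A : {set T} | (#|A| == 2%N) && (subsum A == c)]| <= 2)%N.
Proof.
set F := [set A | _]; apply: contraR; rewrite -ltnNge => gt2.
have tiF : trivIset F.
  apply/trivIsetP=> A B; rewrite !inE => /andP[/eqP oA /eqP sA] /andP[/eqP oB /eqP sB].
  by apply: eq_sum_pairs_disjoint; rewrite ?sA ?sB.
have oF : #|cover F| = (#|F| * 2)%N.
  rewrite -(eqP tiF) -sum_nat_const; apply: eq_bigr => A.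
  by rewrite inE => /andP[/eqP].
have coverF : cover F = setT.
  by apply/eqP; rewrite eqEcard subsetT cardsT oT oF (@leq_mul 3 2).
have oF3 : #|F| = 3%N.
  by move: oF; rewrite coverF cardsT oT; case: #|F| => [|[|[|[]]]].
have : \sum_(A in F) subsum A = 0.
  rewrite /subsum -big_trivIset // coverF -[RHS]sum0; apply: eq_bigl => i.
  by rewrite inE.
rewrite (eq_bigr (fun=> c)); last by move=> A; rewrite inE => /andP[_ /eqP].
rewrite sumr_const oF3 -scaler_nat => /eqP.
by rewrite scaler_eq0 Num.Theory.pnatr_eq0.
Qed.

Hypothesis transH : [transitive H, on [set: T] | 'P].
Variables i1 i2 i3 i4 : T.
Hypothesis uniq_i : uniq [:: i1; i2; i3; i4].
Hypothesis rel_i : t i1 + t i2 = t i3 + t i4.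
Hypothesis nz_i : t i1 + t i2 != 0.

(** With [b] the common sum of the pairs [Q1] and [Q2], the two remaining
    points [rest] have sum -2b. The conjugates of [rest] are the [blocks]; they
    are eventually shown to partition [T]. *)
Let Q1 := [set i1; i2].
Let Q2 := [set i3; i4].
Let rest := ~: (Q1 :|: Q2).

Let card_Q1 : #|Q1| = 2%N.
Proof. by rewrite cards2; case/andP: uniq_i; rewrite !inE !negb_or => /and3P[->]. Qed.

Let card_Q2 : #|Q2| = 2%N.
Proof. by rewrite cards2; case/and4P: uniq_i; rewrite !inE !negb_or => _ _ ->. Qed.

Let Q1_I_Q2 : Q1 :&: Q2 = set0.
Proof.
apply/eqP; rewrite setI_eq0 disjoints_subset; apply/subsetP=> i.
move: uniq_i; rewrite /= !inE !negb_or !andbT.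
case/and3P=> /and3P[_ n13 n14] /andP[n23 n24] _.
by case/orP=> /eqP->; rewrite ?n13 ?n14 ?n23 ?n24.
Qed.

Let sum_Q1 : subsum Q1 = t i1 + t i2.
Proof.
by apply: subsum_pair; move: uniq_i; rewrite /= !inE !negb_or eq_sym; case/and4P=> /andP[].
Qed.

Let sum_Q2 : subsum Q2 = subsum Q1.
Proof.
rewrite sum_Q1 rel_i; apply: subsum_pair.
by move: uniq_i; rewrite /= !inE !negb_or (eq_sym i4); case/and4P.
Qed.

Let card_rest : #|rest| = 2%N.
Proof.
have := cardsC (Q1 :|: Q2); rewrite cardsU Q1_I_Q2 cards0 card_Q1 card_Q2 oT subn0.
by move/addnI.
Qed.

Let sum_rest : subsum rest = - (subsum Q1 *+ 2).
Proof.
have := sum0; rewrite (bigID [in Q1 :|: Q2]) /= -[X in X + _]/(subsum _).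
have -> : subsum (Q1 :|: Q2) = subsum Q1 *+ 2.
  rewrite /subsum (big_setID Q1) /= setIUl setIid (setIC Q2) Q1_I_Q2 setU0 setDUl setDv set0U.
  by rewrite (setDidPl _) 1?disjoint_sym -?setI_eq0 ?Q1_I_Q2 //
    -[X in _ + X]/(subsum _) sum_Q2.
move/eqP; rewrite addr_eq0 => /eqP ->; rewrite opprK.
by apply: eq_bigl => i; rewrite inE.
Qed.

Let blocks := [set (h : {perm T}) @: rest | h in H].
(** For a block [e] with sum -2c, these are the pairs of sum c; dividing by -2
    is avoided. *)
Let half_opp_pairs (e : {set T}) :=
  [set A : {set T} | (#|A| == 2%N) && (subsum A *+ 2 == - subsum e)].

Let blocks_act h e : h \in H -> e \in blocks -> (h : {perm T}) @: e \in blocks.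
Proof.
move=> Hh /imsetP[g Hg ->]; apply/imsetP; exists (g * h)%g; first exact: groupM.
by rewrite imset_permM.
Qed.

Let card_block e : e \in blocks -> #|e| = 2%N.
Proof. by case/imsetP=> g Hg ->; rewrite card_perm_imset. Qed.

Let sum_Q1_act_neq0 (h : {perm T}) : h \in H -> subsum (h @: Q1) != 0.
Proof.
move=> Hh; apply: contraNneq nz_i => S0; rewrite -sum_Q1.
have [sigma [_ sS]] := subsum_act (groupVr Hh).
by rewrite -[Q1]imset_perm1 -(mulgV h) imset_permM -sS S0 raddf0.
Qed.

Let sum_rest_act (h : {perm T}) :
  h \in H -> subsum (h @: rest) = - (subsum (h @: Q1) *+ 2).
Proof.
by case/subsum_act=> sigma [_ sS]; rewrite -!sS sum_rest raddfN raddfMn.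
Qed.

Let sum_Q2_act (h : {perm T}) : h \in H -> subsum (h @: Q2) = subsum (h @: Q1).
Proof. by case/subsum_act=> sigma [_ sS]; rewrite -!sS sum_Q2. Qed.

Let Q_act_neq (h : {perm T}) : h @: Q1 != h @: Q2.
Proof.
apply/negP=> /eqP/(imset_inj (@perm_inj _ h)) eqQ.
by have := card_Q1; rewrite -[Q1]setIid {2}eqQ Q1_I_Q2 cards0.
Qed.

(** The two image pairs are there by transport, and there is no room for
    others by [card_eq_sum_pairs]. *)
Let half_opp_act (h : {perm T}) : h \in H ->
  half_opp_pairs (h @: rest) = [set h @: Q1; h @: Q2].
Proof.
move=> Hh; apply/esym/eqP; rewrite eqEcard; apply/andP; split.
  apply/subsetP=> A /set2P[] ->; rewrite inE card_perm_imset ?card_Q1 ?card_Q2 /=.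
    by rewrite sum_rest_act // opprK.
  by rewrite sum_rest_act // opprK sum_Q2_act.
rewrite cards2 Q_act_neq.
apply: leq_trans (card_eq_sum_pairs (sum_Q1_act_neq0 Hh)).
apply/subset_leq_card/subsetP=> A; rewrite !inE => /andP[-> /=].
by rewrite sum_rest_act // opprK => /eqP/mulr2n_inj->.
Qed.

Let cover_half_opp e : e \in blocks -> cover (half_opp_pairs e) = ~: e.
Proof.
case/imsetP=> h Hh ->; rewrite half_opp_act // /cover bigcup_setU !big_set1 -imsetU.
by apply/setP=> i; rewrite -!preim_permV in_setC ![_ \in _ @^-1: _]inE /rest in_setC negbK.
Qed.

(** A block is the complement of the two pairs of minus half its sum, hence it
    is recovered from that sum. *)
Let sum_block_inj : {in blocks &, injective subsum}.
Proof.
move=> e e' Oe Oe' eqS; apply: setC_inj.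
by rewrite -!cover_half_opp // /half_opp_pairs eqS.
Qed.

(** Otherwise two blocks, which are conjugate, would have sums of ratio -2. *)
Let half_opp_notblock e A : e \in blocks -> A \in half_opp_pairs e -> A \notin blocks.
Proof.
case/imsetP=> h Hh ->; rewrite inE => /andP[_ /eqP SA].
apply/imsetP=> -[g Hg defA]; case/eqP: (sum_Q1_act_neq0 Hg).
have : subsum A = 0.
  apply: (@subsum_conj_neq_N2 (g^-1 * h)); rewrite ?groupM ?groupV //.
  rewrite SA opprK {1}defA; congr subsum.
  by rewrite -!imset_permM mulgA mulgV mul1g.
rewrite defA sum_rest_act // => /eqP; rewrite oppr_eq0 -scaler_nat scaler_eq0.
by rewrite Num.Theory.pnatr_eq0 => /eqP.
Qed.

Let card_half_opp e : e \in blocks -> #|half_opp_pairs e| = 2%N.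
Proof.
by case/imsetP=> h Hh ->; rewrite half_opp_act // cards2 Q_act_neq.
Qed.

(** Each block accounts for three pairs: itself and its two [half_opp_pairs].
    No pair is used twice, and there are only 15 pairs. *)
Let card_blocks_le5 : (#|blocks| <= 5)%N.
Proof.
rewrite -(@leq_pmul2r 3) // -[(5 * 3)%N]/'C(6, 2) -oT -card_draws.
have -> : (#|blocks| * 3 = \sum_(e in blocks) #|e |: half_opp_pairs e|)%N.
  rewrite -sum_nat_const; apply: eq_bigr => e Oe.
  rewrite cardsU1 card_half_opp //; suff -> : e \notin half_opp_pairs e by [].
  by apply/negP=> /(half_opp_notblock Oe)/negP.
pose D e A := A \in e |: half_opp_pairs e.
have Dle1 A : (\sum_(e in blocks) D e A <= (#|A| == 2%N))%N.
  have D2 e : e \in blocks -> D e A -> #|A| = 2%N.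
    by move=> Oe /setU1P[->|]; [apply: card_block | rewrite inE => /andP[/eqP]].
  have D1 e e' : e \in blocks -> e' \in blocks -> D e A -> D e' A -> e = e'.
    move=> Oe Oe' /setU1P[eA|fA] /setU1P[eA'|fA'].
    - by rewrite -eA.
    - by case/negP: (half_opp_notblock Oe' fA'); rewrite eA.
    - by case/negP: (half_opp_notblock Oe fA); rewrite eA'.
    apply: sum_block_inj => //; apply: oppr_inj.
    by move: fA fA'; rewrite !inE => /andP[_ /eqP <-] /andP[_ /eqP <-].
  have [/pred0P D0 | /pred0Pn[e /andP[/= Oe De]]] :=
      boolP (pred0b [pred e in blocks | D e A]).
    by rewrite big1 // => e Oe; have := D0 e; rewrite /= Oe /= => ->.
  rewrite (bigD1 e) //= De big1 ?(D2 e) // => e' /andP[Oe' ne'].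
  by case De': (D e' A) => //; case/eqP: ne'; apply: D1.
rewrite (eq_bigr (fun e => \sum_(A : {set T}) D e A)%N); last first.
  move=> e _; rewrite -sum1_card big_mkcond.
  by apply: eq_bigr => A _; rewrite /D; case: ifP.
rewrite exchange_big /= -sum1_card.
rewrite [X in (_ <= X)%N]big_mkcond /=; apply: leq_sum => A _.
by rewrite inE; apply: leq_trans (Dle1 A) _; case: (_ == _).
Qed.

Let deg i := #|[set e in blocks | i \in e]|.

Let deg_const i j : deg i = deg j.
Proof.
suff le_deg k l : (deg k <= deg l)%N by apply/eqP; rewrite eqn_leq !le_deg.
have [h Hh ->] : exists2 h : {perm T}, h \in H & l = h k.
  by apply: (atransP2 transH); rewrite inE.
rewrite /deg -(card_imset _ (imset_inj (@perm_inj _ h))).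
apply/subset_leq_card/subsetP=> _ /imsetP[e /[!inE]/andP[Oe ke] ->].
by rewrite blocks_act // mem_imset //; apply: perm_inj.
Qed.

(** Counting incidences between the six points and the blocks of size 2 gives
    6 * deg = 2 * #|blocks| with at most five blocks, which forces
    deg = 1 and three blocks: the blocks form a system of imprimitivity. *)
Let card_blocks i : deg i = 1%N /\ #|blocks| = 3%N.
Proof.
have eq_deg : (6 * deg i = #|blocks| * 2)%N.
  rewrite -oT -sum_nat_const -sum_nat_const.
  transitivity (\sum_(j in T) \sum_(e in blocks) (j \in e))%N.
    apply: eq_bigr => j _; rewrite (deg_const i j) /deg -sum1_card.
    rewrite big_mkcond [RHS]big_mkcond; apply: eq_bigr => e _.
    by rewrite inE; case: (e \in blocks); case: (j \in e).
  rewrite exchange_big; apply: eq_bigr => e Oe; rewrite -(card_block Oe) -sum1_card.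
  by rewrite [RHS]big_mkcond; apply: eq_bigr => j _; case: (j \in e).
have O_gt0 : (0 < #|blocks|)%N.
  by apply/card_gt0P; exists ((1%g : {perm T}) @: rest); apply: imset_f (group1 H).
have := card_blocks_le5; move: (deg i) eq_deg O_gt0.
by move: #|blocks| => m n *; split; lia.
Qed.

Let partner_ex i : exists j, j != i /\ [set i; j] \in blocks.
Proof.
have [] := card_blocks i => /eqP/cards1P[e def_e] _.
have : e \in [set e in blocks | i \in e] by rewrite def_e set11.
rewrite inE => /andP[Oe ie].
by have [j nj def] := pair_setP (card_block Oe) ie; exists j; rewrite -def.
Qed.

Let partner i := odflt i [pick j | (j != i) && ([set i; j] \in blocks)].

Let partnerP i : partner i != i /\ [set i; partner i] \in blocks.
Proof.
rewrite /partner; case: pickP => [j /andP[]|p0] //=.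
by have [j [nj Oj]] := partner_ex i; have := p0 j; rewrite nj Oj.
Qed.

Let block_unique e e' i : e \in blocks -> e' \in blocks -> i \in e -> i \in e' -> e = e'.
Proof.
have [] := card_blocks i => /eqP/cards1P[e0 def0] _ Oe Oe' ie ie'.
have eq0 f : f \in blocks -> i \in f -> f = e0.
  by move=> Of fi; apply/set1P; rewrite -def0 inE Of.
by rewrite (eq0 e) // (eq0 e').
Qed.

Let block_partner e i : e \in blocks -> i \in e -> e = [set i; partner i].
Proof. by move=> Oe ie; apply: block_unique (partnerP i).2 ie _; rewrite ?set21. Qed.

Let partner_eq i j : j != i -> [set i; j] \in blocks -> partner i = j.
Proof.
move=> nij Oij; have /setP/(_ j) := block_partner Oij (set21 i j).
by rewrite set22 !inE (negPf nij) => /esym/eqP.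
Qed.

Let partnerK i : partner (partner i) = i.
Proof. by have [n O1] := partnerP i; apply: partner_eq; rewrite 1?eq_sym // setUC. Qed.

Let partner_act (h : {perm T}) i : h \in H -> partner (h i) = h (partner i).
Proof.
move=> Hh; have [n O1] := partnerP i; apply: partner_eq; first by rewrite (inj_eq perm_inj).
by have := blocks_act Hh O1; rewrite imsetU !imset_set1.
Qed.

(** With blocks written as {s + u, s - u}, this is 2u: the gap changes sign when
    the two points of a block are exchanged. *)
Let gap i := t i - t (partner i).

Let gap_neq0 i : gap i != 0.
Proof. by rewrite subr_eq0 (inj_eq injt) eq_sym (partnerP i).1. Qed.

Let gap_partner i : gap (partner i) = - gap i.
Proof. by rewrite /gap partnerK opprB. Qed.

Let gap_pm i j := (gap i == gap j) || (gap i == - gap j).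

Let gap_pm_refl i : gap_pm i i. Proof. by rewrite /gap_pm eqxx. Qed.

Let gap_pm_sym i j : gap_pm i j = gap_pm j i.
Proof. by rewrite /gap_pm [gap i == - _]eq_sym eqr_oppLR [gap i == gap j]eq_sym. Qed.

Let gap_pm_trans i j k : gap_pm i j -> gap_pm j k -> gap_pm i k.
Proof.
by rewrite /gap_pm => /orP[] /eqP-> //; rewrite eqr_opp eqr_oppLR orbC.
Qed.

Let gap_act h : h \in H -> exists sigma : {additive V -> V},
   forall i, sigma (gap i) = gap ((h : {perm T}) i).
Proof.
move=> Hh; have [sigma [sE _]] := subsum_act Hh; exists sigma => j.
by rewrite /gap raddfB !sE partner_act.
Qed.

Let gap_pm_act (h : {perm T}) i j : h \in H -> gap_pm i j -> gap_pm (h i) (h j).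
Proof.
case/gap_act=> sigma sE; rewrite /gap_pm -!sE -raddfN.
by case/orP=> /eqP->; rewrite eqxx ?orbT.
Qed.

Let rest_block : rest \in blocks.
Proof. by rewrite -[rest]imset_perm1; apply: imset_f (group1 H). Qed.

Let partner_notrest i : i \notin rest -> partner i \notin rest.
Proof.
move=> notPi; apply: contra notPi => Ppi.
by rewrite (block_partner rest_block Ppi) partnerK set22.
Qed.

Let notrestE i : (i \notin rest) = [|| i == i1, i == i2, i == i3 | i == i4].
Proof. by rewrite in_setC negbK !inE -orbA. Qed.

(** The pair {[i1], [i2]} is not a block, so the partners of [i1] and [i2] are
    [i3] and [i4] in some order. Then the relation
    [t i1 + t i2 = t i3 + t i4] says exactly that the gaps at [i1] and [i2]
    are opposite. *)
Let gap_pm_base j : j \notin rest -> gap_pm i1 j.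
Proof.
have n12 : i1 != i2 by move: uniq_i; rewrite /= !inE !negb_or; case/andP=> /andP[].
have p12 : partner i1 != i2.
  have Q1fib : Q1 \in half_opp_pairs rest.
    by rewrite -[rest]imset_perm1 half_opp_act // imset_perm1 set21.
  apply: contra (half_opp_notblock rest_block Q1fib) => /eqP p12.
  by rewrite /Q1 -[i2]p12 (partnerP i1).2.
(* The relation is symmetric in [i3] and [i4], so [k] and [l] stand for
   either order. *)
have gap_of_partner k l : partner i1 = k -> (k == i3) && (l == i4) || (k == i4) && (l == i3) ->
    j \notin rest -> gap_pm i1 j.
  move=> pk kl.
  have rel : t i1 + t i2 = t k + t l.
    case/orP: kl => /andP[/eqP-> /eqP->]; first exact: rel_i.
    by rewrite rel_i addrC.
  have p2 : partner i2 = l.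
    have : partner i2 \notin rest by apply: partner_notrest; rewrite notrestE eqxx orbT.
    rewrite notrestE (negPf (partnerP i2).1) /= => /orP[/eqP p21|].
      by case/eqP: p12; rewrite -p21 partnerK.
    have nk : partner i2 != k by rewrite -pk (can_eq partnerK) eq_sym.
    case/orP: kl => /andP[/eqP ek /eqP ->]; move: nk; rewrite ek => /negPf-> //=.
      by move/eqP.
    by rewrite orbF => /eqP.
  have eqd12 : gap_pm i1 i2.
    rewrite /gap_pm /gap pk p2 opprB; apply/orP; right.
    by rewrite subr_eq addrAC eq_sym subr_eq addrC -rel.
  have eqdp i : gap_pm i (partner i) by rewrite /gap_pm gap_partner opprK eqxx orbT.
  have j_in : j \notin rest -> [|| j == i1, j == i2, j == k | j == l].
    rewrite notrestE; case/orP: kl => /andP[/eqP-> /eqP->] //.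
    by rewrite [(j == i4) || _]orbC.
  move/j_in; case/or4P=> /eqP-> //; first by rewrite -pk.
  by rewrite -p2; apply: gap_pm_trans (eqdp i2).
have : partner i1 \notin rest by apply: partner_notrest; rewrite notrestE eqxx.
rewrite (notrestE (partner i1)) (negPf (partnerP i1).1) (negPf p12) /= => /orP[] /eqP pi1.
  by apply: (gap_of_partner i3 i4); rewrite ?eqxx.
by apply: (gap_of_partner i4 i3); rewrite ?eqxx ?orbT.
Qed.

(** Since there are three blocks, one of them, say [h @: rest], contains
    neither point; transporting by [h] reduces to the points outside [rest]. *)
Let gap_pm_all i j : gap_pm i j.
Proof.
have [e Oe ne] : exists2 e, e \in blocks & (i \notin e) && (j \notin e).
  have : (0 < #|blocks :\: [set [set i; partner i]; [set j; partner j]]|)%N.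
    rewrite cardsD (card_blocks i).2 subn_gt0.
    by apply: leq_ltn_trans (subset_leq_card (subsetIr _ _)) _; rewrite cards2; case: (_ != _).
  case/card_gt0P=> e; rewrite !inE negb_or => /andP[/andP[ni nj] Oe].
  exists e => //; apply/andP; split.
    by apply: contra ni => ie; apply/eqP/block_partner.
  by apply: contra nj => ie; apply/eqP/block_partner.
case/imsetP: Oe ne => h Hh ->; rewrite -!preim_permV ![_ \in _ @^-1: _]inE => /andP[ni nj].
rewrite -(permKV h i) -(permKV h j); apply: gap_pm_act => //.
by apply: gap_pm_trans (gap_pm_base nj); rewrite gap_pm_sym gap_pm_base.
Qed.

(** The group acts on the three blocks, and it multiplies all gaps by one
    common sign. If both actions of an element are trivial, then it fixes every
    point, since exchanging two partners changes the sign of their gap. *)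
Theorem six_point_relation_isog :
  [\/ H \isog [set: 'D_12], H \isog [set: 'S_3] | H \isog [set: 'Z_6] ]%g.
Proof.
have oO := (card_blocks i1).2.
pose b (k : 'I_3) := enum_val (cast_ord (esym oO) k).
have b_inj : injective b by apply: inj_comp enum_val_inj (@cast_ord_inj _ _ _).
have b_onto e : e \in blocks -> exists k, e = b k.
  move=> Oe; exists (cast_ord oO (enum_rank_in Oe e)).
  by rewrite /b cast_ordK enum_rankK_in.
have [] := @stable_family_morphism _ H _
  (fun (e : {set T}) (h : {perm T}) => h @: e) _ b b_inj.
- by move=> k; apply: imset_perm1.
- by move=> g h _ _ k; apply: imset_permM.
- by move=> h Hh k; apply: b_onto; apply: blocks_act => //; apply: enum_valP.
move=> f fE.
(* The sign by which [h] acts on the gaps, read off at [i1]. *)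
pose eps (h : {perm T}) := gap (h i1) != gap i1.
have dNd i : (- gap i == gap i) = false.
  apply/negP=> /eqP dN; case/eqP: (gap_neq0 i); apply: mulr2n_inj.
  by rewrite mul0rn mulr2n -{1}dN addNr.
have dE (h : {perm T}) i : h \in H -> gap (h i) = if eps h then - gap i else gap i.
  move=> Hh; have [sigma sE] := gap_act Hh.
  have d1 : sigma (gap i1) = if eps h then - gap i1 else gap i1.
    have := gap_pm_all (h i1) i1; rewrite sE /gap_pm /eps.
    by case: (gap (h i1) =P gap i1) => [-> // | _ /= /eqP].
  rewrite -sE; case/orP: (gap_pm_all i i1) => /eqP->; rewrite ?raddfN d1 //.
  by case: (eps h).
apply: (@embed_sym3_sign_isog _ _ f eps).
- move=> g h Hg Hh; rewrite {1}/eps permM !dE //.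
  by case: (eps h); case: (eps g); rewrite ?opprK ?eqxx ?dNd.
- move=> h Hh fh1 eh; apply/permP=> i; rewrite perm1.
  have [k bk] := b_onto _ (partnerP i).2.
  have : h i \in [set i; partner i].
    by rewrite bk -[b k]/(b k) -{1}[k]perm1 -fh1 -fE // -bk imset_f ?set21.
  case/set2P=> // hi; have := dE h i Hh; rewrite hi eh gap_partner => /eqP.
  by rewrite dNd.
by rewrite -oT -cardsT (atrans_dvd transH).
Qed.

End Configuration.

(** * Galois action on the conjugates *)

Lemma galois_roots_perm (F0 : fieldType) (L : splittingFieldType F0)
    (E : {subfield L}) (a : L) (r : seq L) :
  is_normal_closure <<1; a>>%AS E -> uniq r ->
  minPoly 1 a = \prod_(x <- r) ('X - x%:P) ->
  exists f : {morphism 'Gal(E / 1)%g >-> {perm 'I_(size r)}},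
    [/\ {in 'Gal(E / 1)%g, forall (g : gal_of E) i,
           g (tnth (in_tuple r) i) = tnth (in_tuple r) (f g i)},
        ('injm f)%g
      & [transitive f @* 'Gal(E / 1), on [set: 'I_(size r)] | 'P]%g].
Proof.
case=> sKE nE minE Ur Dp; set G := 'Gal(E / 1)%g.
have Ea : a \in E by apply: (subvP sKE); apply: memv_adjoin.
have memr x : (x \in r) = root (minPoly 1 a) x by rewrite Dp root_prod_XsubC.
have rE x : x \in r -> x \in E.
  rewrite memr => /(normalField_root_minPoly (sub1v E) nE Ea)[g _ <-].
  exact: memv_gal.
pose t := tnth (in_tuple r); have tr i : t i \in r by apply: mem_tnth.
have t_onto x : x \in r -> exists i, x = t i.
  by move=> rx; have /tnthP[i ->] : x \in in_tuple r by []; exists i.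
have t_inj : injective t by apply/tuple_uniqP.
have [] := @stable_family_morphism _ [group of G] _ (fun x (g : gal_of E) => g x) _ t t_inj.
- by move=> i; apply: gal_id.
- by move=> g h _ _ i; rewrite galM ?rE.
- move=> g Gg i; apply: t_onto; rewrite memr.
  rewrite -(fixedPoly_gal (sub1v E) Gg (minPolyOver 1%AS a)) /=.
  by rewrite fmorph_root -memr.
move=> f fE; exists f; split=> //.
  apply/subsetP=> g /morphpreP[Gg /set1P fg1]; apply/set1P/eqP/gal_eqP=> x Ex.
  rewrite gal_id.
  (* [M] is a splitting field, hence normal, and it contains [a]; so it contains
     the normal closure [E], and automorphisms of [E] that fix the roots are
     trivial. *)
  pose M : {subfield L} := <<1 & r>>%AS.
  have sEM : (E <= M)%VS.
    apply: minE.
      apply/FadjoinP; split; first exact: sub1v.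
      by apply: seqv_sub_adjoin; rewrite memr root_minPoly.
    apply/(splitting_normalField (sub1v _)); exists (minPoly 1 a).
      exact: minPolyOver.
    by exists r; rewrite // Dp eqpxx.
  have sMF : (M <= fixedField [set g])%VS.
    apply/Fadjoin_seqP; split; first exact: sub1v.
    move=> y /t_onto[i ->]; apply/fixedFieldP; first exact: rE.
    by move=> _ /set1P->; rewrite fE // fg1 perm1.
  have /mem_fixedFieldP[_ /(_ g (set11 g))] := subvP (subv_trans sEM sMF) x Ex.
  by [].
have [i0 a_i0] := t_onto a (etrans (memr a) (root_minPoly _ _)).
apply/imsetP; exists i0; rewrite ?inE //; apply/esym/eqP.
rewrite -subTset; apply/subsetP=> i _.
have := tr i; rewrite memr => /(normalField_root_minPoly (sub1v E) nE Ea)[g Gg gi].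
apply/orbitP; exists (f g); first exact: mem_morphim.
by apply: t_inj; rewrite -gi [in RHS]a_i0 fE.
Qed.

Theorem theorem4 (alpha : algC)
    (deg_alpha : alg_degree alpha = 6%N)
    (tr_alpha : alg_trace alpha = 0)
    (conj_rel : exists a1 a2 a3 a4 : algC,
       [/\ [/\ a1 \in alg_conjugates alpha, a2 \in alg_conjugates alpha,
               a3 \in alg_conjugates alpha & a4 \in alg_conjugates alpha],
           uniq [:: a1; a2; a3; a4],
           a1 + a2 = a3 + a4
         & a1 + a2 \notin Crat])
    (L : splittingFieldType rat) (iota : {rmorphism L -> algC})
    (a : L) (iota_a : iota a = alpha)
    (E : {subfield L}) (clE : is_normal_closure <<1; a>>%AS E) :
  [\/ 'Gal(E / 1) \isog [set: 'D_12],
      'Gal(E / 1) \isog [set: 'S_3]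
    | 'Gal(E / 1) \isog [set: 'Z_6] ]%g.
Proof.
have [sKE nE _] := clE.
have Ea : a \in E by apply: (subvP sKE); apply: memv_adjoin.
have [r _ Dp] := normalFieldP nE a Ea.
have conj_r : perm_eq (map iota r) (alg_conjugates alpha).
  apply: prod_XsubC_eq; rewrite -minCpoly_alg_conjugates -iota_a.
  rewrite minCpoly_minPoly Dp rmorph_prod big_map; apply: eq_bigr => x _ /=.
  by rewrite rmorphB /= map_polyX map_polyC.
have Ur : uniq r.
  by rewrite -(map_inj_uniq (fmorph_inj iota)) (perm_uniq conj_r) alg_conjugates_uniq.
have sz_r : size r = 6%N.
  by rewrite -(size_map iota) (perm_size conj_r) size_alg_conjugates.
have sum_r : \sum_(x <- r) x = 0.
  apply: (fmorph_inj iota); rewrite rmorph0 rmorph_sum -[RHS]tr_alpha /alg_trace.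
  by rewrite -(perm_big _ conj_r) big_map.
have [f [fE injf transf]] := galois_roots_perm clE Ur Dp.
pose t := tnth (in_tuple r).
have t_inj : injective t by apply/tuple_uniqP.
have lin_f : {in (f @* 'Gal(E / 1))%g, forall h : {perm 'I_(size r)},
    exists sigma : {additive L -> L}, forall i, sigma (t i) = t (h i)}.
  move=> _ /morphimP[g _ Gg ->].
  by exists (fun_of_lfun (gal_repr g)) => i; apply: fE.
have lift z : z \in alg_conjugates alpha -> exists i, z = iota (t i).
  rewrite -(perm_mem conj_r) => /mapP[x rx ->].
  by have /tnthP[i ->] : x \in in_tuple r by []; exists i.
have [a1 [a2 [a3 [a4 [[/lift[i1 ->] /lift[i2 ->] /lift[i3 ->] /lift[i4 ->]]]]]]] :=
  conj_rel.
rewrite -!rmorphD => uniq_a /(fmorph_inj iota) rel12 notQ.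
have uniq_i : uniq [:: i1; i2; i3; i4].
  by apply: (@map_uniq _ _ (iota \o t)).
have nz12 : t i1 + t i2 != 0.
  by apply: contraNneq notQ => ->; rewrite rmorph0 rpred0.
have oT : #|'I_(size r)| = 6%N by rewrite card_ord.
have sum0 : \sum_i t i = 0 by rewrite -[RHS]sum_r [RHS]big_tnth.
have isoG : ('Gal(E / 1) \isog (f @* 'Gal(E / 1)))%g.
  by apply/isogP; exists f.
have [isoH | isoH | isoH] :=
  six_point_relation_isog lin_f t_inj oT sum0 transf uniq_i rel12 nz12.
- by apply: Or31; apply: isog_trans isoH.
- by apply: Or32; apply: isog_trans isoH.
- by apply: Or33; apply: isog_trans isoH.
Qed.
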